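(* Let $0<\epsilon<0.01$ be a constant. For $x$ sufficiently large and $N$ an $(l,x)$-factorable number with \[ \frac{x}{(\log x)^{C_0+100}}\le l\le \frac{x}{(\log x)^{C_0+10}}, \] we have \[ \textsf{r}^{\mathbb{C}}_{\mathrm{DFT}_N}\left(\frac{N}{\exp\left(\epsilon^6(\log N)^{0.36}\right)}\right)\le N^{7\epsilon}. \]
   Context: Let $C$ be an absolute constant such that (by a theorem of Baker and Harman) there is $x_0$ with: for all $x>x_0$ and $y\ge x^{0.2961}$, the number of primes $p\le x$ such that every prime factor of $p-1$ is at most $y$ exceeds $x/(\log x)^C$. Set $C_0=C+1$. A prime $q$ is $x$-good if $x/(\log x)^{C_0}\le q\le x$ and every prime power dividing $q-1$ is at most $x^{0.3}$. An integer $N$ is $(l,x)$-factorable if $N=q_1\cdots q_l$ for distinct $x$-good primes $q_1,\dots,q_l$. $\mathrm{DFT}_N$ is the $N\times N$ complex matrix with entries $\omega^{xy}$, $0\le x,y\le N-1$, $\omega=e^{2\pi i/N}$. $\textsf{r}^{\mathbb{F}}_M(r)$ is the smallest $s$ such that $M=A+B$ over $\mathbb{F}$ with $A$ having at most $s$ nonzero entries in each row and column and $\operatorname{rank}(B)\le r$. *)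

(* Defs.v *)
(* The real numbers are an arbitrary
   R : realType and the complex numbers are R[i]. *)
From mathcomp Require Import all_boot all_order all_algebra.
From mathcomp Require Import complex.
From mathcomp Require Import all_classical all_reals all_analysis.

Set Implicit Arguments.
Unset Strict Implicit.
Unset Printing Implicit Defensive.

Import Order.TTheory GRing.Theory Num.Theory.

Local Open Scope ring_scope.

Section Sparsity_and_rigidity.
Variables (F : fieldType) (n : nat).

Definition row_col_sparse (s : nat) (A : 'M[F]_n) : bool :=
  [forall i, (#|[set j | A i j != 0%R]| <= s)%N] &&
  [forall j, (#|[set i | A i j != 0%R]| <= s)%N].

Definition sparse_plus_low_rank (R : realType) (M : 'M[F]_n) (r : R)
    (s : nat) : Prop :=
  exists A B : 'M[F]_n,
    [/\ M = A + B, row_col_sparse s A & (\rank B)%:R <= r].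

Lemma sparse_plus_low_rank_ex (R : realType) (M : 'M[F]_n)
    (r : {nonneg R}) :
  exists s, `[< sparse_plus_low_rank M r%:num s >].
Proof.
have le_n (P : pred 'I_n) : (#|[set i | P i]| <= n)%N.
  by rewrite -[leqRHS]card_ord max_card.
exists n; apply/asboolP; exists M, 0; split.
- by rewrite addr0.
- by apply/andP; split; apply/forallP.
- by rewrite mxrank0; exact: ge0.
Qed.

(* The rank bound r is a nonnegative real that need not be an integer; for
   r < 0 no decomposition exists. *)
Definition rigidity (R : realType) (M : 'M[F]_n) (r : {nonneg R}) : nat :=
  ex_minn (sparse_plus_low_rank_ex M r).

End Sparsity_and_rigidity.

Section DFT.
Variable R : realType.

Definition dft_root (N : nat) : R[i] :=
  Complex (cos (2 * pi / N%:R)) (sin (2 * pi / N%:R)).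

Definition DFT (N : nat) : 'M[R[i]]_N :=
  \matrix_(j, k) dft_root N ^+ (j * k).

End DFT.

Section Good_primes.
Variable R : realType.

Definition num_smooth_shifted_primes (x y : R) : nat :=
  #|[set p : 'I_(Num.truncn x).+1 |
      prime p && all (fun q : nat => q%:R <= y) (primes p.-1)]|.

(* The property of the constant C provided by the theorem of Baker and
   Harman. *)
Definition Baker_Harman (C : R) : Prop :=
  exists x0 : R, forall x y : R, x0 < x -> x `^ (2961 / 10000) <= y ->
    x / (ln x `^ C) < (num_smooth_shifted_primes x y)%:R.

(* The exponent C0 is C + 1, with C as in Baker_Harman. *)
Definition good_prime (C0 x : R) (q : nat) : Prop :=
  [/\ prime q,
      x / (ln x `^ C0) <= q%:R <= x &
      forall p k : nat, prime p -> (0 < k)%N -> (p ^ k %| q.-1)%N ->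
        (p ^ k)%:R <= x `^ (3 / 10)].

Definition factorable (C0 : R) (l : nat) (x : R) (N : nat) : Prop :=
  exists qs : seq nat,
    [/\ size qs = l, uniq qs, (forall q, q \in qs -> good_prime C0 x q) &
        N = (\prod_(q <- qs) q)%N].

End Good_primes.

(* Main.v *)
(* Up to permuting rows and columns, DFT_N is the Kronecker product of the
   matrices DFT_q over the l primes q dividing N.  As DFT_q ^ 4 = q ^ 2, each
   factor is sqrt q times a diagonalizable matrix with eigenvalues i ^ b,
   b in {0, 1, 2, 3}, so DFT_N = c i ^ L, where L is the sum over the l factors
   of the matrix with eigenvalue b in place of i ^ b.  The matrix L has at most
   l x nonzero entries in each row and column, and its eigenvalues, being sums
   of l independent bounded terms, lie within t = eps l of their mean for all
   but a fraction 2 exp (- eps^2 l / 72) of the eigenvectors.  If p is the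
   polynomial of degree about 2 eps l with p (s) = c i ^ s at the integers s of
   that window, then A = p (L) is sparse and DFT_N - A has small rank. *)
Require Import Defs.
From mathcomp Require Import all_boot all_order all_algebra.
From mathcomp Require Import fingroup perm.
From mathcomp Require Import complex mxtens.
From mathcomp Require Import all_classical all_reals all_analysis.
From mathcomp Require Import ring lra zify.

Set Implicit Arguments.
Unset Strict Implicit.
Unset Printing Implicit Defensive.

Import Order.TTheory GRing.Theory Num.Theory.

Local Open Scope ring_scope.

Section Sparsity.
Variable F : fieldType.

Definition row_sparse (s m n : nat) (A : 'M[F]_(m, n)) : Prop :=
  forall i, (#|[set j | A i j != 0%R]| <= s)%N.

Definition sparse (s n : nat) (A : 'M[F]_n) : Prop :=
  row_sparse s A /\ row_sparse s A^T.

Lemma sparseP s n (A : 'M[F]_n) : sparse s A -> row_col_sparse s A.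
Proof.
move=> [rA cA]; apply/andP; split; apply/forallP => i; first exact: rA.
apply: leq_trans (cA i); rewrite subset_leq_card//.
by apply/fintype.subsetP => j; rewrite !inE mxE.
Qed.

Lemma row_sparse_le s t m n (A : 'M[F]_(m, n)) :
  (s <= t)%N -> row_sparse s A -> row_sparse t A.
Proof. by move=> st sA i; exact: leq_trans (sA i) st. Qed.

Lemma row_sparseD s t m n (A B : 'M[F]_(m, n)) :
  row_sparse s A -> row_sparse t B -> row_sparse (s + t) (A + B).
Proof.
move=> sA sB i; apply: leq_trans (leq_add (sA i) (sB i)).
rewrite (leq_trans _ (leq_card_setU _ _))// subset_leq_card//.
apply/fintype.subsetP => j; rewrite !inE mxE; apply: contraR.
by rewrite negb_or !negbK => /andP[/eqP-> /eqP->]; rewrite addr0.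
Qed.

Lemma row_sparseM s t m n p (A : 'M[F]_(m, n)) (B : 'M[F]_(n, p)) :
  row_sparse s A -> row_sparse t B -> row_sparse (s * t) (A *m B).
Proof.
have card_sum (I : finType) (h : pred I) : #|[set j | h j]| = (\sum_j h j)%N.
  by rewrite -sum1dep_card big_mkcond; apply: eq_bigr => j _; case: (h j).
move=> sA sB i; rewrite (@leq_trans (\sum_(k | A i k != 0%R) t))//; last first.
  by rewrite sum_nat_cond_const leq_mul2r sA orbT.
rewrite (@leq_trans (\sum_(k | A i k != 0%R) \sum_j (B k j != 0%R)))//.
  rewrite card_sum exchange_big; apply: leq_sum => j _.
  have [//|ABij] := eqVneq ((A *m B) i j) 0.
  rewrite lt0n; apply: contra ABij => /eqP/eqP; rewrite sum_nat_eq0.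
  move=> /forall_inP AB; rewrite mxE; apply/eqP/big1 => k _.
  have [->|/AB] := eqVneq (A i k) 0; first by rewrite mul0r.
  by have [->|//] := eqVneq (B k j) 0; rewrite mulr0.
by apply: leq_sum => k _; rewrite -card_sum; exact: sB.
Qed.

Lemma row_sparse_scalar n (a : F) : row_sparse 1 (a%:M : 'M[F]_n).
Proof.
move=> i; rewrite -(cards1 i) subset_leq_card//; apply/fintype.subsetP => j.
by rewrite !inE mxE [i == j]eq_sym; case: (j == i); rewrite ?mulr0n ?eqxx.
Qed.

Lemma row_sparse_tens s t m n p q (A : 'M[F]_(m, n)) (B : 'M[F]_(p, q)) :
  row_sparse s A -> row_sparse t B -> row_sparse (s * t) (A *t B).
Proof.
move=> sA sB i; case: (mxtens_indexP i) => i1 i2.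
rewrite (leq_trans _ (leq_mul (sA i1) (sB i2)))//.
rewrite -cardsX -(card_imset _ (can_inj (@mxtens_indexK n q))).
rewrite subset_leq_card//; apply/fintype.subsetP => j.
case: (mxtens_indexP j) => j1 j2; rewrite !inE tensmxE mulf_eq0 negb_or => ?.
by apply/imsetP; exists (j1, j2); rewrite ?inE.
Qed.

Lemma sparse_le s t n (A : 'M[F]_n) : (s <= t)%N -> sparse s A -> sparse t A.
Proof. by move=> st [? ?]; split; exact: row_sparse_le st _. Qed.

Lemma sparseD s t n (A B : 'M[F]_n) :
  sparse s A -> sparse t B -> sparse (s + t) (A + B).
Proof.
by move=> [? ?] [? ?]; rewrite /sparse linearD; split; exact: row_sparseD.
Qed.

Lemma sparseM s t n (A B : 'M[F]_n) :
  sparse s A -> sparse t B -> sparse (s * t) (A *m B).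
Proof.
move=> [? ?] [? ?]; rewrite /sparse trmx_mul; split; first exact: row_sparseM.
by rewrite mulnC; exact: row_sparseM.
Qed.

Lemma sparse_scalar n (a : F) : sparse 1 (a%:M : 'M[F]_n).
Proof. by rewrite /sparse tr_scalar_mx; split; exact: row_sparse_scalar. Qed.

Lemma sparse_tens s t m n (A : 'M[F]_m) (B : 'M[F]_n) :
  sparse s A -> sparse t B -> sparse (s * t) (A *t B).
Proof.
by move=> [? ?] [? ?]; rewrite /sparse trmx_tens; split; exact: row_sparse_tens.
Qed.

Lemma sparse_dim n (A : 'M[F]_n) : sparse n A.
Proof. by split=> i; rewrite -[leqRHS]card_ord max_card. Qed.

Lemma sparse_perm s n (A B : 'M[F]_n) (f g : 'S_n) :
  (forall i j, A i j = B (f i) (g j)) -> sparse s B -> sparse s A.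
Proof.
move=> AB [sB cB]; split=> i.
- rewrite (leq_trans _ (sB (f i)))// -(card_imset _ (@perm_inj _ g)).
  rewrite subset_leq_card//; apply/fintype.subsetP => _ /imsetP[j + ->].
  by rewrite !inE AB.
- rewrite (leq_trans _ (cB (g i)))// -(card_imset _ (@perm_inj _ f)).
  rewrite subset_leq_card//; apply/fintype.subsetP => _ /imsetP[j + ->].
  by rewrite !inE !mxE AB.
Qed.

Lemma mxrank_perm n (A B : 'M[F]_n) (f g : 'S_n) :
  (forall i j, A i j = B (f i) (g j)) -> \rank A = \rank B.
Proof.
move=> AB; have -> : A = row_perm f (col_perm g B).
  by apply/matrixP => i j; rewrite AB !mxE.
rewrite row_permE col_permE eqmxMfull ?mxrankMfree//.
  by rewrite row_free_unit unitmx_perm.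
by rewrite row_full_unit unitmx_perm.
Qed.

Lemma tens_scalar1 m n : (1%:M : 'M[F]_m) *t (1%:M : 'M[F]_n) = 1%:M.
Proof.
apply/matrixP => i j; case: (mxtens_indexP i) => i1 i2.
case: (mxtens_indexP j) => j1 j2; rewrite tensmxE !mxE.
rewrite (inj_eq (can_inj (@mxtens_indexK m n))) xpair_eqE.
by case: eqP => _; case: eqP => _; rewrite ?mulr1 ?mulr0.
Qed.

Definition mx_of_eigen n (P Q : 'M[F]_n) (f : 'I_n -> F) : 'M[F]_n :=
  P *m diag_mx (\row_k f k) *m Q.

Section Eigen.
Variables (n : nat) (P Q : 'M[F]_n).
Hypothesis QP : Q *m P = 1%:M.

Lemma mx_of_eigenD f g :
  mx_of_eigen P Q f + mx_of_eigen P Q g = mx_of_eigen P Q (fun k => f k + g k).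
Proof.
rewrite /mx_of_eigen -mulmxDl -mulmxDr -linearD; congr (_ *m diag_mx _ *m _).
by apply/rowP => k; rewrite !mxE.
Qed.

Lemma mx_of_eigenZ a f :
  a *: mx_of_eigen P Q f = mx_of_eigen P Q (fun k => a * f k).
Proof.
rewrite /mx_of_eigen scalemxAl scalemxAr -linearZ; congr (_ *m diag_mx _ *m _).
by apply/rowP => k; rewrite !mxE.
Qed.

Lemma mx_of_eigenM f g :
  mx_of_eigen P Q f *m mx_of_eigen P Q g = mx_of_eigen P Q (fun k => f k * g k).
Proof.
rewrite /mx_of_eigen !mulmxA -[_ *m Q *m P]mulmxA QP mulmx1.
rewrite -[_ *m diag_mx _ *m diag_mx _]mulmxA mulmx_diag.
by congr (_ *m diag_mx _ *m _); apply/rowP => k; rewrite !mxE.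
Qed.

Lemma mx_of_eigenC a : mx_of_eigen P Q (fun=> a) = a%:M.
Proof.
rewrite /mx_of_eigen (_ : \row_k a = const_mx a); last first.
  by apply/rowP => k; rewrite !mxE.
by rewrite diag_const_mx mul_mx_scalar -scalemxAl mulmx1C// scalemx1.
Qed.

Lemma sparse_mx_of_eigen_poly (S : nat) (b : 'I_n -> F) (p : {poly F}) :
  sparse S (mx_of_eigen P Q b) ->
  sparse (S.+1 ^ (size p).-1) (mx_of_eigen P Q (fun k => p.[b k])).
Proof.
move=> Sb; elim/poly_ind: p => [|p c IH].
  rewrite size_poly0 (_ : (fun k => _) = fun=> 0).
    by rewrite mx_of_eigenC expn0; exact: sparse_scalar.
  by apply/funext => k; rewrite horner0.
rewrite size_MXaddC; have [->/=|p0 /=] := eqVneq p 0.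
  rewrite size_poly0 (_ : (fun k => _) = fun=> c).
    by rewrite mx_of_eigenC; case: ifP => _; rewrite expn0; exact: sparse_scalar.
  by apply/funext => k; rewrite !hornerE.
rewrite (_ : (fun k => _) = fun k => p.[b k] * b k + c); last first.
  by apply/funext => k; rewrite !hornerE.
rewrite -mx_of_eigenD -mx_of_eigenM mx_of_eigenC.
apply: sparse_le (sparseD (sparseM IH Sb) (sparse_scalar n c)).
rewrite -(prednK (_ : 0 < size p)%N) ?size_poly_gt0//= expnSr mulnS addnC.
by rewrite leq_add2r expn_gt0.
Qed.

Lemma mxrank_mx_of_eigen f :
  (\rank (mx_of_eigen P Q f) <= #|[set k | f k != 0%R]|)%N.
Proof.
rewrite (leq_trans (mxrankM_maxl _ _))// (leq_trans (mxrankM_maxr _ _))//.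
rewrite -sum1_card (_ : diag_mx _ =
    \sum_(k in [set k | f k != 0%R]) f k *: delta_mx k k); last first.
  rewrite diag_mx_sum_delta [RHS]big_mkcond/=; apply: eq_bigr => k _.
  by rewrite inE mxE; case: eqP => //= ->; rewrite scale0r.
elim/big_rec2: _ => [|k u A _ uA]; first by rewrite mxrank0.
rewrite (leq_trans (mxrank_add _ _))// leq_add//.
by rewrite (leq_trans (mxrank_scale _ _))// mxrank_delta.
Qed.

End Eigen.

Lemma mx_of_eigen_tens m n (P Q : 'M[F]_m) (P' Q' : 'M[F]_n) f g :
  mx_of_eigen P Q f *t mx_of_eigen P' Q' g =
  mx_of_eigen (P *t P') (Q *t Q')
    (fun k => f (mxtens_unindex k).1 * g (mxtens_unindex k).2).
Proof.
rewrite /mx_of_eigen -!tensmx_mul; congr (_ *m _ *m _).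
apply/matrixP => i j; case: (mxtens_indexP i) => i1 i2.
case: (mxtens_indexP j) => j1 j2; rewrite tensmxE !mxE mxtens_indexK/=.
rewrite (inj_eq (can_inj (@mxtens_indexK m n))) xpair_eqE.
by case: eqP => _; case: eqP => _; rewrite ?mulr1n ?mulr0n ?mulr0 ?mul0r.
Qed.

Lemma mx_of_eigen_tensl m n (P Q : 'M[F]_m) (P' Q' : 'M[F]_n) f :
  Q' *m P' = 1%:M ->
  mx_of_eigen P Q f *t 1%:M =
  mx_of_eigen (P *t P') (Q *t Q') (fun k => f (mxtens_unindex k).1).
Proof.
move=> QP; rewrite -(mx_of_eigenC QP 1) mx_of_eigen_tens; congr mx_of_eigen.
by apply/funext => k; rewrite mulr1.
Qed.

Lemma mx_of_eigen_tensr m n (P Q : 'M[F]_m) (P' Q' : 'M[F]_n) f :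
  Q' *m P' = 1%:M ->
  1%:M *t mx_of_eigen P Q f =
  mx_of_eigen (P' *t P) (Q' *t Q) (fun k => f (mxtens_unindex k).2).
Proof.
move=> QP; rewrite -(mx_of_eigenC QP 1) mx_of_eigen_tens; congr mx_of_eigen.
by apply/funext => k; rewrite mul1r.
Qed.

Lemma interpolation (s : seq F) (f : F -> F) : uniq s ->
  exists2 p : {poly F}, (size p <= size s)%N & {in s, forall x, p.[x] = f x}.
Proof.
elim: s => [|a s IH]/=; first by exists 0; rewrite ?size_poly0.
move=> /andP[as_ /IH[p ps pf]]; pose w := \prod_(x <- s) ('X - x%:P).
have wa : w.[a] != 0 by have := as_; rewrite -(root_prod_XsubC s a).
exists (p + ((f a - p.[a]) / w.[a]) *: w).
  rewrite (leq_trans (size_polyD _ _))// geq_max (leq_trans ps)//=.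
  by rewrite (leq_trans (size_scale_leq _ _))// size_prod_XsubC.
move=> x; rewrite inE !hornerE => /orP[/eqP->|xs].
  by rewrite mulfVK// subrKC.
have /rootP -> : root w x by rewrite root_prod_XsubC.
by rewrite mulr0 addr0 pf.
Qed.

End Sparsity.

Section Spectral.
Variable R : realType.
Local Notation C := R[i].

Definition spectral (S l n : nat) (M : 'M[C]_n) : Prop :=
  exists (c : C) (P Q : 'M[C]_n) (b : 'I_n -> nat) (mu : R),
    [/\ Q *m P = 1%:M,
        M = c *: mx_of_eigen P Q (fun k => 'i ^+ b k),
        sparse S (mx_of_eigen P Q (fun k => (b k)%:R)) &
        forall theta : R, `|theta| <= 1 / 6 ->
          \sum_k expR (theta * ((b k)%:R - mu))
            <= n%:R * expR (18 * theta ^+ 2 * l%:R)].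

Lemma spectral_le S T l n (M : 'M[C]_n) :
  (S <= T)%N -> spectral S l M -> spectral T l M.
Proof.
move=> ST [c [P [Q [b [mu [? ? sM ?]]]]]]; exists c, P, Q, b, mu; split => //.
exact: sparse_le sM.
Qed.

Lemma spectral_tens S1 S2 l1 l2 m n (A : 'M[C]_m) (B : 'M[C]_n) :
  spectral S1 l1 A -> spectral S2 l2 B ->
  spectral (S1 + S2) (l1 + l2) (A *t B).
Proof.
move=> [c1 [P1 [Q1 [b1 [mu1 [QP1 AE sA mA]]]]]].
move=> [c2 [P2 [Q2 [b2 [mu2 [QP2 BE sB mB]]]]]].
exists (c1 * c2), (P1 *t P2), (Q1 *t Q2).
exists (fun k => b1 (mxtens_unindex k).1 + b2 (mxtens_unindex k).2)%N.
exists (mu1 + mu2); split.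
- by rewrite tensmx_mul QP1 QP2 tens_scalar1.
- rewrite (_ : mx_of_eigen _ _ _ = mx_of_eigen P1 Q1 (fun k => 'i ^+ b1 k) *t
                                    mx_of_eigen P2 Q2 (fun k => 'i ^+ b2 k)).
    by rewrite AE BE; apply/matrixP => i j; rewrite !mxE mulrACA.
  by rewrite mx_of_eigen_tens; congr mx_of_eigen; apply/funext => k; rewrite exprD.
- rewrite (_ : mx_of_eigen _ _ _ =
      mx_of_eigen P1 Q1 (fun k => (b1 k)%:R) *t 1%:M +
      1%:M *t mx_of_eigen P2 Q2 (fun k => (b2 k)%:R)).
    rewrite -[S1]muln1 -[S2]mul1n.
    by apply: sparseD; apply: sparse_tens => //; exact: sparse_scalar.
  rewrite (mx_of_eigen_tensl P1 Q1 _ QP2) (mx_of_eigen_tensr P2 Q2 _ QP1).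
  rewrite mx_of_eigenD; congr mx_of_eigen; apply/funext => k.
  by rewrite natrD.
- move=> t t6; rewrite !natrD mulrDr expRD natrM mulrACA.
  under eq_bigr => k _.
    rewrite natrD (_ : _ * _ = t * ((b1 (mxtens_unindex k).1)%:R - mu1) +
      t * ((b2 (mxtens_unindex k).2)%:R - mu2)); last by ring.
    rewrite expRD.
    over.
  rewrite -(mulr_sum (fun k => expR (t * ((b1 k)%:R - mu1)))
                     (fun k => expR (t * ((b2 k)%:R - mu2)))).
  by apply: ler_pM; rewrite ?mA ?mB// sumr_ge0// => k _; exact: expR_ge0.
Qed.

Lemma expR_le_quadratic (u : R) : u <= 1 / 2 -> expR u <= 1 + u + 2 * u ^+ 2.
Proof.
move=> u2; have := expR_ge1Dx (- u); rewrite expRN => eu.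
have u1 : 0 < 1 - u by lra.
have : expR u <= (1 - u)^-1.
  by rewrite -[expR u]invrK lef_pV2// posrE invr_gt0 expR_gt0.
move/le_trans; apply; rewrite -[_^-1]mul1r ler_pdivrMr//.
have := sqr_ge0 u; nra.
Qed.

Lemma moment_bound n (b : 'I_n.+1 -> nat) : (forall k, b k < 4)%N ->
  exists mu : R, forall theta : R, `|theta| <= 1 / 6 ->
    \sum_k expR (theta * ((b k)%:R - mu)) <= n.+1%:R * expR (18 * theta ^+ 2).
Proof.
move=> b4; pose mu : R := (\sum_k (b k)%:R) / n.+1%:R; exists mu => t.
rewrite ler_norml => /andP[t6 t6'].
have n0 : (0 : R) < n.+1%:R by rewrite ltr0n.
have b3 k : (b k)%:R <= 3 :> R by rewrite ler_nat -ltnS b4.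
have mu0 : 0 <= mu by rewrite divr_ge0// sumr_ge0.
have mu3 : mu <= 3.
  rewrite ler_pdivrMr// (le_trans (ler_sum _ (fun k _ => b3 k)))//.
  by rewrite sumr_const card_ord mulr_natr.
apply: (@le_trans _ _
  (\sum_k (1 + t * ((b k)%:R - mu) + 2 * t ^+ 2 * 9))).
  apply: ler_sum => k _; have b0 : 0 <= (b k)%:R :> R by [].
  have bk := b3 k.
  have bmu : ((b k)%:R - mu) ^+ 2 <= 9 by nra.
  apply: le_trans (expR_le_quadratic _) _; first by nra.
  by rewrite lerD2l exprMn -mulrA !ler_wpM2l// sqr_ge0.
have centered : \sum_k ((b k)%:R - mu) = 0.
  rewrite big_split/= (_ : \sum_k (b k)%:R = mu * n.+1%:R).
    by rewrite sumr_const card_ord mulNrn mulr_natr subrr.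
  by rewrite mulfVK// gt_eqF.
rewrite !big_split/= -(mulr_sumr _ _ _ t) centered mulr0 addr0 !sumr_const.
rewrite card_ord -mulrnDl -[leLHS]mulr_natl ler_wpM2l//.
rewrite (le_trans _ (expR_ge1Dx _))// lerD2l.
lra.
Qed.

Lemma interpolation_window (f : nat -> C) (mu t : R) : 0 <= t ->
  exists2 p : {poly C}, (size p <= (Num.truncn (2 * t)).+2)%N &
    forall s : nat, `|s%:R - mu| <= t -> p.[s%:R] = f s.
Proof.
move=> t0; set d := Num.truncn (2 * t); pose a := Num.truncn (mu - t).
have inj_natr : injective (fun s : nat => s%:R : C).
  by move=> x y /eqP; rewrite eqr_nat => /eqP.
pose w : seq C := [seq s%:R | s <- iota a d.+2].
pose g (z : C) := f (a + index z w)%N.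
have uw : uniq w by rewrite map_inj_uniq ?iota_uniq.
have [p sp pg] := interpolation g uw.
exists p; first by rewrite (leq_trans sp)// size_map size_iota.
move=> s; rewrite ler_norml => /andP[sl su].
have sa : (a <= s)%N.
  rewrite -(ler_nat R) /a; have [h|h] := leP 0 (mu - t).
    by rewrite (le_trans (_ : _ <= mu - t)) ?truncn_le//; lra.
  by rewrite truncn_floor (lt_geF h) ler_nat.
have sd : (s < a + d.+2)%N.
  rewrite -(ltr_nat R) natrD; have := truncnS_gt (mu - t).
  have := truncnS_gt (2 * t); rewrite -/a -/d -[d.+2]addn1 -(addn1 a) !natrD.
  lra.
have sw : s%:R \in w by rewrite map_f// mem_iota sa.
rewrite pg// /g index_map// (_ : index s _ = s - a)%N ?subnKC//.
rewrite -[X in index X _](subnKC sa) -(nth_iota 0%N a (_ : s - a < d.+2)%N).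
  by rewrite index_uniq ?size_iota ?iota_uniq// ltn_subLR.
by rewrite ltn_subLR.
Qed.

Lemma spectral_tail n (b : 'I_n -> nat) (mu t : R) (l : nat) :
  (0 < l)%N -> 0 <= t <= 6 * l%:R ->
  (forall theta : R, `|theta| <= 1 / 6 ->
     \sum_k expR (theta * ((b k)%:R - mu))
       <= n%:R * expR (18 * theta ^+ 2 * l%:R)) ->
  #|[set k | t < `|(b k)%:R - mu|]|%:R
    <= 2 * n%:R * expR (- (t ^+ 2 / (72 * l%:R))).
Proof.
move=> l0 /andP[t0 t6] mom; have lR : (0 : R) < l%:R by rewrite ltr0n.
pose th := t / (36 * l%:R).
have th0 : 0 <= th by rewrite divr_ge0// mulr_ge0.
have th6 : th <= 1 / 6 by rewrite ler_pdivrMr ?mulr_gt0//; lra.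
have m1 : \sum_k expR (th * ((b k)%:R - mu)) <=
    n%:R * expR (18 * th ^+ 2 * l%:R) by rewrite mom// ger0_norm.
have m2 : \sum_k expR (- th * ((b k)%:R - mu)) <=
    n%:R * expR (18 * th ^+ 2 * l%:R).
  by rewrite -[th ^+ 2]sqrrN mom// normrN ger0_norm.
have -> : expR (- (t ^+ 2 / (72 * l%:R))) =
    expR (18 * th ^+ 2 * l%:R) / expR (th * t).
  rewrite -expRB; congr expR; rewrite /th; field.
  by rewrite gt_eqF.
rewrite mulrA ler_pdivlMr ?expR_gt0// mulrC.
apply: (@le_trans _ _ (\sum_k (expR (th * ((b k)%:R - mu)) +
                               expR (- th * ((b k)%:R - mu))))).
  rewrite -sum1dep_card natr_sum mulr_sumr big_mkcond/=; apply: ler_sum => k _.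
  case: ifP => [|_]; last by rewrite addr_ge0// expR_ge0.
  rewrite mulr1; have [b0|b0] := ler0P ((b k)%:R - mu) => tb.
    rewrite (le_trans (_ : _ <= expR (- th * ((b k)%:R - mu))))//.
      by rewrite ler_expR mulNr -mulrN ler_wpM2l// ltW.
    by rewrite lerDr expR_ge0.
  rewrite (le_trans (_ : _ <= expR (th * ((b k)%:R - mu))))//.
    by rewrite ler_expR ler_wpM2l// ltW.
  by rewrite lerDl expR_ge0.
rewrite big_split/=; lra.
Qed.

Lemma spectral_decomposition S l n (M : 'M[C]_n) (t : R) :
  (0 < l)%N -> 0 <= t <= 6 * l%:R -> spectral S l M ->
  exists A B : 'M[C]_n,
    [/\ M = A + B, sparse (S.+1 ^ (Num.truncn (2 * t)).+1) A &
        (\rank B)%:R <= 2 * n%:R * expR (- (t ^+ 2 / (72 * l%:R)))].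
Proof.
move=> l0 t06 [c [P [Q [b [mu [QP ME sM mom]]]]]].
have /andP[t0 _] := t06.
have [p sp pE] := interpolation_window (fun s => c * 'i ^+ s) mu t0.
exists (mx_of_eigen P Q (fun k => p.[(b k)%:R])).
exists (mx_of_eigen P Q (fun k => c * 'i ^+ b k - p.[(b k)%:R])); split.
- rewrite mx_of_eigenD ME mx_of_eigenZ; congr mx_of_eigen.
  by apply/funext => k; rewrite addrC subrK.
- apply: sparse_le (sparse_mx_of_eigen_poly QP _ sM).
  by rewrite leq_pexp2l//; case: (size p) sp.
- apply: le_trans (spectral_tail l0 t06 mom); rewrite ler_nat.
  rewrite (leq_trans (mxrank_mx_of_eigen _ _ _))// subset_leq_card//.
  apply/fintype.subsetP => k; rewrite !inE; apply: contraR.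
  by rewrite -leNgt => /pE ->; rewrite subrr.
Qed.

End Spectral.

Section Fourier.
Variable R : realType.
Local Notation C := R[i].
Local Notation omega := (dft_root R).

Definition cis (a : R) : C := Complex (cos a) (sin a).

Lemma cis0 : cis 0 = 1.
Proof. by rewrite /cis cos0 sin0. Qed.

Lemma cisD a b : cis (a + b) = cis a * cis b.
Proof.
apply/eqP; rewrite eq_complex /= cosD sinD eqxx/=.
by rewrite addrC.
Qed.

Lemma cisMn a n : cis (n%:R * a) = cis a ^+ n.
Proof.
elim: n => [|n IH]; first by rewrite mul0r cis0.
by rewrite -addn1 natrD mulrDl mul1r cisD IH exprD.
Qed.

Lemma dft_rootX m n : (0 < n)%N -> omega (m * n) ^+ n = omega m.
Proof.
move=> n0; rewrite -[LHS]cisMn; congr cis.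
have n0' : n%:R != 0 :> R by rewrite pnatr_eq0 -lt0n.
case: m => [|m]; first by rewrite mul0n invr0 !mulr0.
have m0 : m.+1%:R != 0 :> R by rewrite pnatr_eq0.
by rewrite natrM; field; rewrite nat1r m0.
Qed.

Lemma dft_root_unity n : (0 < n)%N -> omega n ^+ n = 1.
Proof.
move=> n0; rewrite -[in X in omega X](mul1n n) dft_rootX//.
by rewrite /dft_root divr1 mulr_natl cos2pi sin2pi.
Qed.

Lemma dft_root_neq1 n k : (0 < k < n)%N -> omega n ^+ k != 1.
Proof.
move=> /andP[k0 kn]; rewrite -[_ ^+ k]cisMn.
have n1 : (0 < n)%N by exact: leq_ltn_trans kn.
have n0 : (0 : R) < n%:R by rewrite ltr0n.
pose a : R := pi * k%:R / n%:R.
have -> : k%:R * (2 * pi / n%:R) = a *+ 2 by rewrite /a -mulr_natl; ring.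
apply/eqP => -[]; rewrite cos_mulr2n => cosa _.
have sina : 0 < sin a.
  apply: sin_gt0_pi; rewrite divr_gt0 ?mulr_gt0 ?pi_gt0 ?ltr0n//=.
  by rewrite ltr_pdivrMr// ltr_pM2l ?pi_gt0// ltr_nat.
have : sin a ^+ 2 = 0 by rewrite sin2cos2; lra.
by move/eqP; rewrite sqrf_eq0 gt_eqF.
Qed.

Lemma dft_root_mod n k : (0 < n)%N -> omega n ^+ (k %% n)%N = omega n ^+ k.
Proof. by move=> n0; rewrite expr_mod// dft_root_unity. Qed.

Lemma dft_root_sum n k : (0 < n)%N ->
  \sum_(j < n) omega n ^+ (k * j) = (n %| k)%N%:R * n%:R.
Proof.
move=> n0; rewrite (eq_bigr (fun j : 'I_n => (omega n ^+ k) ^+ j)); last first.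
  by move=> j _; rewrite exprM.
have [nk|nk] := boolP (n %| k)%N.
  rewrite -dft_root_mod// (eqP nk) expr0 mul1r.
  by rewrite (eq_bigr (fun=> 1)) ?sumr_const ?card_ord// => j _; rewrite expr1n.
have z1 : omega n ^+ k != 1.
  by rewrite -dft_root_mod// dft_root_neq1// lt0n nk ltn_pmod.
rewrite mul0r; apply: (mulfI (_ : omega n ^+ k - 1 != 0)).
  by rewrite subr_eq0.
by rewrite -subrX1 exprAC dft_root_unity// expr1n subrr mulr0.
Qed.

Lemma DFT_sqr n : (0 < n)%N ->
  DFT R n *m DFT R n = n%:R *: \matrix_(i, k) (n %| i + k)%N%:R.
Proof.
move=> n0; apply/matrixP => i k; rewrite !mxE mulrC -dft_root_sum//.
by apply: eq_bigr => j _; rewrite !mxE -exprD mulnDl [(j * k)%N]mulnC.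
Qed.

Lemma DFT_fourth n : (0 < n)%N ->
  (DFT R n *m DFT R n) *m (DFT R n *m DFT R n) = (n%:R ^+ 2)%:M.
Proof.
move=> n0; rewrite !DFT_sqr// -scalemxAl -scalemxAr scalerA -expr2.
rewrite -scalemx1; congr (_ *: _); apply/matrixP => i k; rewrite !mxE.
have jn : ((n - i) %% n < n)%N by rewrite ltn_mod.
have idvd (a : 'I_n) : (n %| i + a)%N = (a == Ordinal jn).
  rewrite -val_eqE/=; have := ltn_ord i; have := ltn_ord a => an i_n.
  have [i0|i0] := posnP i.
    by rewrite i0 add0n subn0 modnn /dvdn modn_small.
  rewrite (@modn_small (n - i)); last by lia.
  apply/idP/eqP => [/dvdnP[q]|->]; last by rewrite subnKC// ltnW.
  by case: q => [|[|q]]; nia.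
rewrite (bigD1 (Ordinal jn))//= big1 => [|a aj]; last first.
  by rewrite !mxE idvd (negbTE aj) mul0r.
rewrite !mxE idvd eqxx mul1r addr0 addnC.
have -> : (n %| k + Ordinal jn)%N = (i == k).
  have ii : (n %| i + Ordinal jn)%N by rewrite idvd.
  apply/idP/eqP => [kj|<-//]; apply: val_inj => /=.
  have : (i + Ordinal jn = k + Ordinal jn %[mod n])%N.
    by rewrite (eqP ii) (eqP kj).
  by move/eqP; rewrite eqn_modDr !modn_small// => /eqP.
by [].
Qed.

Lemma quartic_root (d : C) : d ^+ 4 = 1 -> exists2 b, (b < 4)%N & d = 'i ^+ b.
Proof.
move=> d4; have i2 : ('i : C) ^+ 2 = -1 := sqrCi _.
have : (d - 1) * (d - 'i) * (d + 1) * (d + 'i) = 0.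
  have -> : (d - 1) * (d - 'i) * (d + 1) * (d + 'i) =
    d ^+ 4 - (1 + 'i ^+ 2) * d ^+ 2 + 'i ^+ 2 by ring.
  by rewrite i2 d4; ring.
move/eqP; rewrite !mulf_eq0 !subr_eq0 !addr_eq0 -!orbA.
case/or4P => /eqP ->.
- by exists 0%N.
- by exists 1%N.
- by exists 2.
- by exists 3; rewrite // exprS i2 mulrN1.
Qed.

Lemma prod_quartic_roots :
  \prod_(x <- [:: 1; 'i; -1; - 'i]) ('X - x%:P) = 'X^4 - 1 :> {poly C}.
Proof.
have i2 : ('i%:P : {poly C}) ^+ 2 = -1.
  by rewrite -[LHS](rmorphXn (@polyC C)) sqrCi [LHS](rmorphN1 (@polyC C)).
rewrite 3!big_cons big_seq1 !polyCN; move: ('i%:P : {poly C}) i2 => y y2.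
transitivity ('X^4 - (1 + y ^+ 2) * 'X^2 + y ^+ 2); first by ring.
by rewrite y2; ring.
Qed.

Lemma uniq_quartic_roots : uniq [:: 1; 'i; -1; - 'i : C].
Proof.
rewrite -complexiE /= !inE !eq_complex /= oppr0 ?eqxx ?oner_eq0.
have oneN1 : (1 == -1 :> R) = false by apply/eqP; lra.
have zN1 : (0 == -1 :> R) = false by apply/eqP; lra.
have N1z : (-1 == 0 :> R) = false by apply/eqP; lra.
by rewrite oneN1 zN1 N1z andbF.
Qed.

Lemma quartic_diagonalization n (U : 'M[C]_n.+1) :
  (U *m U) *m (U *m U) = 1%:M ->
  exists (P Q : 'M[C]_n.+1) (b : 'I_n.+1 -> nat),
    [/\ Q *m P = 1%:M, forall k, (b k < 4)%N &
        U = mx_of_eigen P Q (fun k => 'i ^+ b k)].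
Proof.
move=> UU; have [P Pu] : diagonalizable U.
  apply/diagonalizableP; exists [:: 1; 'i; -1; - 'i].
    exact: uniq_quartic_roots.
  rewrite prod_quartic_roots; apply: mxminpoly_min.
  rewrite rmorphB rmorphXn rmorph1 /= horner_mx_X.
  by apply/eqP; rewrite subr_eq0 (exprM U 2 2) !expr2 -!mulmxE UU.
move=> /diagonalizable_forPex[D /(simmxP Pu) PUD].
have UE : U = mx_of_eigen (invmx P) P (D 0).
  rewrite /mx_of_eigen (_ : \row_k D 0 k = D).
    by rewrite -mulmxA -PUD mulmxA mulVmx// mul1mx.
  by apply/rowP => k; rewrite !mxE.
have D4 k : D 0 k ^+ 4 = 1.
  have : mx_of_eigen (invmx P) P (fun k => D 0 k ^+ 4) = 1%:M.
    rewrite -UU UE !(mx_of_eigenM (mulmxV Pu)).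
    by congr mx_of_eigen; apply/funext => j; rewrite (exprM _ 2 2) !expr2.
  move/(congr1 (fun A => (P *m A *m invmx P) k k)).
  rewrite /mx_of_eigen !mulmxA mulmxV// mul1mx mulmxK// mulmx1 mulmxV//.
  by rewrite !mxE eqxx.
have [b b4 bE] := fin_all_exists2 (fun k => quartic_root (D4 k)).
exists (invmx P), P, b; split; [exact: mulmxV Pu | exact: b4 |].
by rewrite UE; congr mx_of_eigen; apply/funext => k; rewrite bE.
Qed.

Lemma DFT_spectral n : (0 < n)%N -> spectral n 1 (DFT R n).
Proof.
case: n => // n _; set F := DFT R n.+1; pose c : C := sqrtC n.+1%:R.
have c2 : c ^+ 2 = n.+1%:R by rewrite sqrtCK.
have c0 : c != 0 by rewrite sqrtC_eq0 pnatr_eq0.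
have [|P [Q [b [QP b4 UE]]]] := @quartic_diagonalization n (c^-1 *: F).
  rewrite -!scalemxAl -!scalemxAr -!scalemxAl !scalerA DFT_fourth//.
  by rewrite scale_scalar_mx -c2; congr (_%:M); field; exact: c0.
have [mu mom] := moment_bound R b4.
exists c, P, Q, b, mu; split => //.
- by rewrite -UE scalerA mulfV// scale1r.
- exact: sparse_dim.
- by move=> t t6; rewrite mulr1 mom.
Qed.

Definition perm_equiv n (A B : 'M[C]_n) : Prop :=
  exists f g : 'S_n, forall i j, A i j = B (f i) (g j).

Lemma perm_equiv_trans n (A B D : 'M[C]_n) :
  perm_equiv A B -> perm_equiv B D -> perm_equiv A D.
Proof.
move=> [f [g AB]] [f' [g' BD]]; exists (f * f')%g, (g * g')%g => i j.
by rewrite AB BD !permM.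
Qed.

Lemma perm_equiv_sym n (A B : 'M[C]_n) : perm_equiv A B -> perm_equiv B A.
Proof.
by move=> [f [g AB]]; exists (f^-1)%g, (g^-1)%g => i j; rewrite AB !permKV.
Qed.

Lemma perm_equiv_tens m n (A : 'M[C]_m) (B D : 'M[C]_n) :
  perm_equiv B D -> perm_equiv (A *t B) (A *t D).
Proof.
move=> [f [g BD]].
pose lift (h : 'S_n) (k : 'I_(m * n)) :=
  mxtens_index ((mxtens_unindex k).1, h (mxtens_unindex k).2).
have lift_inj h : injective (lift h).
  move=> i j; case: (mxtens_indexP i) => i1 i2; case: (mxtens_indexP j) => j1 j2.
  rewrite /lift !mxtens_indexK /= => /(can_inj (@mxtens_indexK m n))[-> /perm_inj ->//].
exists (perm (@lift_inj f)), (perm (@lift_inj g)) => i j; rewrite !permE.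
case: (mxtens_indexP i) => i1 i2; case: (mxtens_indexP j) => j1 j2.
by rewrite /lift !mxtens_indexK !tensmxE BD.
Qed.

Lemma coprime_mulr_inj c d a b : (a < d)%N -> (b < d)%N -> coprime d c ->
  (a * c == b * c %[mod d])%N -> a = b.
Proof.
wlog ab : a b / (a <= b)%N => [hw ad bd dc e|ad bd dc].
  have [/hw|/ltnW/hw] := leqP a b; first exact.
  by rewrite eq_sym in e => h; apply/esym/h.
rewrite eq_sym eqn_mod_dvd ?leq_mul2r ?ab ?orbT// -mulnBl Gauss_dvdl//.
rewrite -eqn_mod_dvd// !modn_small// => /eqP.
by [].
Qed.

(* The rows are indexed by k1 n + k2 m and the columns by the Chinese remainder
   isomorphism, since (k1 n + k2 m) y / (m n) = k1 y / m + k2 y / n. *)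
Lemma DFT_tens m n : (0 < m)%N -> (0 < n)%N -> coprime m n ->
  perm_equiv (DFT R (m * n)) (DFT R m *t DFT R n).
Proof.
move=> m0 n0 mn; have mn0 : (0 < m * n)%N by rewrite muln_gt0 m0.
pose row (k : 'I_(m * n)) := Ordinal (ltn_pmod
  ((mxtens_unindex k).1 * n + (mxtens_unindex k).2 * m) mn0).
pose col (k : 'I_(m * n)) := Ordinal (ltn_pmod
  (chinese m n (mxtens_unindex k).1 (mxtens_unindex k).2) mn0).
have row_inj : injective row.
  move=> i j; case: (mxtens_indexP i) => i1 i2; case: (mxtens_indexP j) => j1 j2.
  move/(congr1 val); rewrite /row !mxtens_indexK /= => /eqP.
  rewrite chinese_remainder// => /andP[].
  rewrite [(i1 * n + _)%N]addnC [(j1 * n + _)%N]addnC !modnMDl => e1.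
  rewrite addnC [X in (_ == X %% _)%N]addnC !modnMDl => e2.
  congr (mxtens_index (_, _)); apply: val_inj => /=.
    by apply: coprime_mulr_inj e1.
  by apply: coprime_mulr_inj e2; rewrite // coprime_sym.
have col_inj : injective col.
  move=> i j; case: (mxtens_indexP i) => i1 i2; case: (mxtens_indexP j) => j1 j2.
  move/(congr1 val); rewrite /col !mxtens_indexK /= => /eqP.
  rewrite chinese_remainder// !chinese_modl// !chinese_modr// !modn_small//.
  by move=> /andP[/eqP/val_inj-> /eqP/val_inj->].
apply: perm_equiv_sym; exists (perm row_inj), (perm col_inj) => i j.
rewrite !permE; case: (mxtens_indexP i) => i1 i2; case: (mxtens_indexP j) => j1 j2.
rewrite tensmxE !mxE /row /col !mxtens_indexK /=.
rewrite -[RHS]dft_root_mod// modnMml modnMmr dft_root_mod// mulnDl exprD.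
set y := chinese m n j1 j2.
rewrite (_ : (i1 * n * y)%N = (n * (i1 * y))%N); last by lia.
rewrite (_ : (i2 * m * y)%N = (m * (i2 * y))%N); last by lia.
rewrite [_ ^+ (n * _)]exprM dft_rootX// [_ ^+ (m * _)]exprM.
rewrite [X in omega X ^+ m]mulnC dft_rootX//.
congr (_ * _).
  rewrite -dft_root_mod// -[RHS]dft_root_mod//; congr (_ ^+ _).
  by rewrite -[RHS]modnMmr chinese_modl// modnMmr.
rewrite -dft_root_mod// -[RHS]dft_root_mod//; congr (_ ^+ _).
by rewrite -[RHS]modnMmr chinese_modr// modnMmr.
Qed.

Lemma DFT_prod (X : nat) (qs : seq nat) :
  uniq qs -> (forall q, q \in qs -> prime q /\ (q <= X)%N) ->
  exists2 K : 'M[C]_(\prod_(q <- qs) q),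
    perm_equiv (DFT R (\prod_(q <- qs) q)) K &
    spectral (size qs * X) (size qs) K.
Proof.
elim: qs => [_ _|q qs IH /= /andP[qqs uqs] qsX].
  rewrite big_nil; exists (DFT R 1).
    by exists 1%g, 1%g => i j; rewrite !perm1.
  exists 1, 1%:M, 1%:M, (fun=> 0%N), 0; split.
  - by rewrite mulmx1.
  - rewrite mx_of_eigenC ?mulmx1// scale1r; apply/matrixP => i j.
    by rewrite !mxE !ord1 expr0.
  - rewrite mx_of_eigenC ?mulmx1//.
    by split=> i; rewrite eq_card0// => j; rewrite !inE !mxE mul0rn eqxx.
  - by move=> t _; rewrite sumr_const card_ord subr0 mulr0 mulr0 expR0 mul1r.
have [q_prime qX] := qsX q (mem_head _ _).
have [a aqs|K K_dft K_spec] := IH uqs; first by apply: qsX; rewrite inE aqs orbT.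
rewrite big_cons; exists (DFT R q *t K).
  apply: perm_equiv_trans (perm_equiv_tens _ K_dft).
  have coprime_prod (s : seq nat) : q \notin s -> {in s, forall r, prime r} ->
      coprime q (\prod_(r <- s) r)%N.
    elim: s => [|r s IHs]; first by rewrite big_nil coprimen1.
    rewrite inE negb_or big_cons coprimeMr => /andP[qr qs_] pr.
    rewrite prime_coprime// dvdn_prime2 ?qr ?(pr r) ?mem_head//=.
    by apply: IHs => // a as_; rewrite pr// inE as_ orbT.
  have prod_gt0 : (0 < \prod_(r <- qs) r)%N.
    rewrite big_seq prodn_cond_gt0// => a aqs.
    by rewrite prime_gt0//; apply: (qsX _ _).1; rewrite inE aqs orbT.
  apply: DFT_tens => //; first exact: prime_gt0.
  by apply: coprime_prod => // a aqs; apply: (qsX _ _).1; rewrite inE aqs orbT.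
rewrite mulSn -add1n; apply: spectral_tens => //.
by apply: spectral_le (DFT_spectral (prime_gt0 q_prime)).
Qed.

End Fourier.

Lemma rigidity_le (F : fieldType) n (R : realType) (M : 'M[F]_n)
    (r : {nonneg R}) s :
  sparse_plus_low_rank M r%:num s -> (rigidity M r <= s)%N.
Proof.
by move=> Ms; rewrite /rigidity; case: ex_minnP => m _; apply; apply/asboolP.
Qed.

Section Non_rigidity.
Variable R : realType.

Lemma DFT_prod_decomposition (X : nat) (qs : seq nat) (t : R) :
  (0 < size qs)%N -> uniq qs ->
  (forall q, q \in qs -> prime q /\ (q <= X)%N) ->
  0 <= t <= 6 * (size qs)%:R ->
  sparse_plus_low_rank (DFT R (\prod_(q <- qs) q))
    (2 * (\prod_(q <- qs) q)%:R * expR (- (t ^+ 2 / (72 * (size qs)%:R))))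
    ((size qs * X).+1 ^ (Num.truncn (2 * t)).+1).
Proof.
move=> l0 uqs qsX t06.
have [K [f [g DK]] K_spec] := @DFT_prod R X qs uqs qsX.
have [A [B [KAB sA rB]]] := spectral_decomposition l0 t06 K_spec.
pose A' := \matrix_(i, j) A (f i) (g j); pose B' := \matrix_(i, j) B (f i) (g j).
exists A', B'; split.
- by apply/matrixP => i j; rewrite DK KAB !mxE.
- by apply: sparseP; apply: (sparse_perm (f := f) (g := g)) sA => i j; rewrite mxE.
- rewrite (@mxrank_perm _ _ B' B f g)// => i j.
  by rewrite mxE.
Qed.

Lemma powR_ln_le (K a : R) : 0 < a ->
  exists x0 : R, forall x, x0 < x -> ln x `^ K <= x `^ a.
Proof.
move=> a0; pose m := `|K| + 1; pose y0 : R := (2 * m / a) ^+ 2 + 1.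
have m0 : 0 < m by rewrite ltr_wpDl.
exists (expR y0) => x xy0.
have x0 : 0 < x by rewrite (lt_trans _ xy0)// expR_gt0.
have yx : y0 < ln x by rewrite -ltr_expR lnK.
have y1 : 1 < ln x by rewrite (le_lt_trans _ yx)// lerDr sqr_ge0.
have y0' : 0 < ln x by rewrite (lt_trans _ y1).
rewrite (le_trans (ler_powR (ltW y1) (_ : K <= m)))//.
  by rewrite (le_trans (ler_norm K))// lerDl.
rewrite /powR !gt_eqF// ler_expR; set s := Num.sqrt (ln x).
have s0 : 0 < s by rewrite sqrtr_gt0.
have s2 : s ^+ 2 = ln x by rewrite sqr_sqrtr// ltW.
have ms : 2 * m / a <= s.
  have ma0 : 0 <= 2 * m / a by rewrite divr_ge0 ?mulr_ge0// ltW.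
  rewrite -(@ler_pXn2r _ 2) ?nnegrE// ?sqrtr_ge0// s2.
  by rewrite (le_trans _ (ltW yx))// lerDl.
rewrite -s2 lnXn// -mulr_natl.
have := ln_sublinear s0; move: ms; rewrite ler_pdivrMr//; nra.
Qed.

Lemma powR_ge_near_pinfty (B a : R) : 0 < a ->
  exists x0 : R, forall x, x0 < x -> B <= x `^ a.
Proof.
move=> a0; exists (expR (B / a)) => x Bx.
have x0 : 0 < x by rewrite (lt_trans _ Bx)// expR_gt0.
rewrite /powR gt_eqF// (le_trans _ (expR_ge1Dx _))//.
have : B / a < ln x by rewrite -ltr_expR lnK.
rewrite ltr_pdivrMr//; lra.
Qed.

Lemma prod_ge_expn (z : R) (qs : seq nat) : 0 <= z ->
  (forall q, q \in qs -> z <= q%:R) -> z ^+ size qs <= (\prod_(q <- qs) q)%:R.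
Proof.
move=> z0; elim: qs => [|q qs IH] zq; first by rewrite big_nil expr0.
rewrite big_cons natrM exprS ler_pM ?exprn_ge0//.
  by rewrite zq ?mem_head.
by apply: IH => r rqs; rewrite zq// inE rqs orbT.
Qed.

Lemma prod_le_expn (z : R) (qs : seq nat) :
  (forall q, q \in qs -> q%:R <= z) -> (\prod_(q <- qs) q)%:R <= z ^+ size qs.
Proof.
elim: qs => [|q qs IH] zq; first by rewrite big_nil expr0.
rewrite big_cons natrM exprS ler_pM//.
  by rewrite zq ?mem_head.
by apply: IH => r rqs; rewrite zq// inE rqs orbT.
Qed.

Section Large_x.
Variables (C0 eps x : R) (l : nat).
Hypotheses (eps_bounds : 0 < eps < 1 / 100) (x_gt1 : 1 < x).
Hypothesis lnC0_le : ln x `^ C0 <= x `^ (1 / 14).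
Hypothesis l_bounds : x `^ (9 / 10) <= l%:R <= x.
Hypothesis x18_ge : 144 / eps ^+ 2 <= x `^ (18 / 100).
Hypothesis x12_ge : 8 <= x `^ (1 / 2).

Let x0 : 0 < x. Proof. exact: lt_trans x_gt1. Qed.
Let x_ge1 : 1 <= x. Proof. exact: ltW. Qed.
Let x_ge0 : 0 <= x. Proof. exact: ltW. Qed.

Lemma rank_saving (lnN : R) : 0 <= lnN <= l%:R * ln x ->
  2 * expR (- ((eps * l%:R) ^+ 2 / (72 * l%:R)))
    <= (expR (eps ^+ 6 * lnN `^ (36 / 100)))^-1.
Proof.
move=> /andP[lnN0 lnNl]; have /andP[e0 e1] := eps_bounds.
have /andP[xl lx] := l_bounds.
have l0 : (0 : R) < l%:R by rewrite (lt_le_trans _ xl)// powR_gt0.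
have e6 : eps ^+ 6 <= 1 by rewrite exprn_ile1 ?ltW//; lra.
have lnN_le : lnN `^ (36 / 100) <= x `^ (72 / 100).
  rewrite (_ : 72 / 100 = 2 * (36 / 100)); last by lra.
  rewrite [x `^ _]powRrM ge0_ler_powR ?nnegrE ?powR_ge0//.
  rewrite powR_mulrn// expr2 (le_trans lnNl)//.
  by rewrite ler_pM ?ln_ge0// ltW// ln_sublinear.
have x72 : 1 <= x `^ (72 / 100).
  by rewrite -[leLHS](powRr0 x) ler_powR.
have x90 : 144 / eps ^+ 2 * x `^ (72 / 100) <= x `^ (9 / 10).
  rewrite (_ : 9 / 10 = 18 / 100 + 72 / 100); last by lra.
  by rewrite powRD ?gt_eqF ?implybT// ler_wpM2r ?powR_ge0.
apply: (@le_trans _ _ (expR 1 * expR (- ((eps * l%:R) ^+ 2 / (72 * l%:R))))).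
  by rewrite ler_wpM2r ?expR_ge0// (le_trans _ (expR_ge1Dx _)).
rewrite -expRD -expRN ler_expR.
have -> : (eps * l%:R) ^+ 2 / (72 * l%:R) = eps ^+ 2 * l%:R / 72 :> R.
  by field; rewrite gt_eqF.
have : 144 * x `^ (72 / 100) <= eps ^+ 2 * l%:R.
  rewrite -ler_pdivrMl ?exprn_gt0// (le_trans _ xl)// (le_trans _ x90)//.
  by rewrite mulrA [_^-1 * _]mulrC.
have : eps ^+ 6 * lnN `^ (36 / 100) <= x `^ (72 / 100).
  by rewrite (le_trans _ lnN_le)// ler_piMl ?powR_ge0.
lra.
Qed.

Lemma sparsity_bound (X N : nat) : X%:R <= x ->
  (x / ln x `^ C0) ^+ l <= N%:R ->
  ((l * X).+1 ^ (Num.truncn (2 * (eps * l%:R))).+1)%:R <= N%:R `^ (7 * eps).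
Proof.
move=> Xx zN; have /andP[e0 e1] := eps_bounds; have /andP[xl lx] := l_bounds.
set t := eps * l%:R; pose z := x / ln x `^ C0.
have l0 : (0 : R) < l%:R by rewrite (lt_le_trans _ xl)// powR_gt0.
have x72 : 1 <= x `^ (72 / 100).
  by rewrite -[leLHS](powRr0 x) ler_powR.
have x90 : x `^ (9 / 10) = x `^ (18 / 100) * x `^ (72 / 100).
  by rewrite -powRD ?gt_eqF ?implybT//; congr (_ `^ _); lra.
have t1 : 1 <= t.
  have : 144 / eps ^+ 2 <= l%:R.
    by rewrite (le_trans _ xl)// x90 (le_trans x18_ge)// ler_peMr// powR_ge0.
  rewrite ler_pdivrMr ?exprn_gt0// /t; nra.
have t0 : 0 <= t by exact: le_trans t1.
have lnC0_gt0 : 0 < ln x `^ C0 by rewrite powR_gt0// ln_gt0.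
have z0 : 0 < z by rewrite divr_gt0.
have z_ge0 : 0 <= z := ltW z0.
have x2_ge0 : 0 <= 2 * x ^+ 2 by rewrite mulr_ge0 ?exprn_ge0.
have zx : x `^ (13 / 14) <= z.
  rewrite ler_pdivlMr// (le_trans (_ : _ <= x `^ (13 / 14) * x `^ (1 / 14)))//.
    by rewrite ler_wpM2l ?powR_ge0.
  rewrite -powRD ?gt_eqF ?implybT//.
  by rewrite (_ : 13 / 14 + 1 / 14 = 1) ?powRr1//; lra.
have z7 : (2 * x ^+ 2) ^+ 3 <= z ^+ 7.
  apply: (@le_trans _ _ ((x `^ (13 / 14)) ^+ 7)); last first.
    by rewrite lerXn2r ?nnegrE ?powR_ge0.
  rewrite -[leRHS]powR_mulrn ?powR_ge0// -powRrM.
  rewrite (_ : 13 / 14 * 7%:R = 6%:R + 1 / 2); last by lra.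
  rewrite powRD ?gt_eqF ?implybT// powR_mulrn//.
  rewrite (_ : (2 * x ^+ 2) ^+ 3 = x ^+ 6 * 8); last by ring.
  by rewrite ler_wpM2l ?exprn_ge0.
apply: (@le_trans _ _ ((2 * x ^+ 2) `^ (3 * t))).
  rewrite natrX -[leLHS]powR_mulrn//.
  apply: (@le_trans _ _ ((2 * x ^+ 2) `^ (Num.truncn (2 * t)).+1%:R)).
    rewrite ge0_ler_powR ?nnegrE//.
    rewrite -addn1 natrD natrM.
    have : l%:R * X%:R <= x * x by rewrite ler_pM.
    have : 1 <= x * x by rewrite -[leLHS]mulr1 ler_pM.
    lra.
  rewrite ler_powR//.
    have : 1 <= x ^+ 2 by rewrite exprn_ege1.
    lra.
  rewrite -addn1 natrD.
  have : (Num.truncn (2 * t))%:R <= 2 * t by rewrite truncn_le mulr_ge0.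
  lra.
rewrite [_ `^ (3 * t)]powRrM powR_mulrn//.
apply: (@le_trans _ _ ((z ^+ 7) `^ t)).
  by rewrite ge0_ler_powR ?nnegrE ?exprn_ge0.
apply: (@le_trans _ _ ((z ^+ l) `^ (7 * eps))).
  have powRX (k : nat) u : (z ^+ k) `^ u = z `^ (k%:R * u).
    by rewrite -powR_mulrn// -powRrM.
  rewrite !powRX.
  by rewrite (_ : 7%:R * t = l%:R * (7 * eps))// /t; ring.
by rewrite ge0_ler_powR ?nnegrE ?exprn_ge0// mulr_ge0// ltW.
Qed.

End Large_x.

End Non_rigidity.

Theorem theorem4p7 (R : realType) (C : R) (hC : Baker_Harman C)
    (eps : R) (heps : 0 < eps < 1 / 100) :
  exists x1 : R, forall (x : R) (l N : nat),
    x1 < x ->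
    factorable (C + 1) l x N ->
    x / (ln x `^ (C + 1 + 100)) <= l%:R <= x / (ln x `^ (C + 1 + 10)) ->
    (rigidity (DFT R N)
       (N%:R / expR (eps ^+ 6 * ln N%:R `^ (36 / 100)))%:nng)%:R
      <= N%:R `^ (7 * eps).
Proof.
have [xa xaP] := @powR_ln_le R (C + 1) (1 / 14) ltac:(lra).
have [xb xbP] := @powR_ln_le R (C + 1 + 100) (1 / 10) ltac:(lra).
have [xc xcP] := @powR_ge_near_pinfty R (144 / eps ^+ 2) (18 / 100) ltac:(lra).
have [xd xdP] := @powR_ge_near_pinfty R 8 (1 / 2) ltac:(lra).
exists (Num.max 1 (Num.max (Num.max xa xb) (Num.max xc xd))) => x l N.
rewrite !gt_max => /andP[x1 /andP[/andP[/xaP lnC0 /xbP lnC100] /andP[/xcP x18 /xdP x12]]].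
move=> [qs [<- {l} uqs good ->{N}]] /andP[l_ge _].
have x0 : 0 < x by exact: lt_trans x1.
have lnx0 : 0 < ln x by rewrite ln_gt0.
set l := size qs in l_ge *; set N := (\prod_(q <- qs) q)%N.
have qs_le q : q \in qs -> prime q /\ (q <= Num.truncn x)%N.
  move=> /good[pq /andP[_ qx] _]; split => //.
  by rewrite truncn_ge_nat// ltW.
have truncx : (Num.truncn x)%:R <= x by rewrite truncn_le ltW.
have l_le : l%:R <= x.
  rewrite (le_trans _ truncx)// ler_nat -(size_iota 1 (Num.truncn x)).
  apply: uniq_leq_size => // q /qs_le[pq qx].
  by rewrite mem_iota prime_gt0// add1n ltnS.
have l_bounds : x `^ (9 / 10) <= l%:R <= x.
  rewrite l_le andbT (le_trans _ l_ge)// ler_pdivlMr ?powR_gt0//.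
  rewrite (@le_trans _ _ (x `^ (9 / 10) * x `^ (1 / 10)))//.
    by rewrite ler_wpM2l ?powR_ge0.
  rewrite -powRD ?gt_eqF ?implybT// (_ : 9 / 10 + 1 / 10 = 1); last by lra.
  by rewrite powRr1// ltW.
have l0 : (0 < l)%N.
  rewrite -(ltr_nat R); case/andP: l_bounds => + _; apply: lt_le_trans.
  by rewrite powR_gt0.
have N_ge : (x / ln x `^ (C + 1)) ^+ l <= N%:R.
  apply: prod_ge_expn => [|q /good[_ /andP[//]]].
  by rewrite divr_ge0 ?powR_ge0// ltW.
have N_le : N%:R <= x ^+ l by apply: prod_le_expn => q /good[_ /andP[]].
have N0 : (0 : R) < N%:R.
  by apply: lt_le_trans N_ge; rewrite exprn_gt0// divr_gt0// powR_gt0.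
have lnN : 0 <= ln (N%:R : R) <= l%:R * ln x.
  rewrite ln_ge0 ?ler1n -?(ltr0n R)//= mulr_natl -lnXn// ler_ln// posrE.
  by rewrite exprn_gt0.
apply: le_trans (sparsity_bound heps x1 lnC0 l_bounds x18 x12 truncx N_ge).
have /andP[e0 e1] := heps.
rewrite ler_nat; apply: rigidity_le.
have [|A [B [DAB sA rB]]] := @DFT_prod_decomposition R _ qs (eps * l%:R) l0 uqs qs_le.
  by rewrite mulr_ge0 ?(ltW e0)//= ler_wpM2r//; lra.
exists A, B; split => //=.
apply: le_trans rB _; rewrite -/N -/l [2 * _]mulrC -mulrA ler_wpM2l//.
exact: (rank_saving heps x1 l_bounds x18 lnN).
Qed.
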